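(* Let $(\mathcal S,\mathcal A,C,f,r,\gamma)$ be a metric MDP and $\Pi$ a policy class such that: (i) $C(s)$ is compact for every $s\in\mathcal S$, and $C$ is upper hemicontinuous; (ii) $f:\mathrm{Graph}(C)\to\mathcal S$ is continuous; (iii) $r:\mathrm{Graph}(C)\to\mathbb R$ is upper semicontinuous and bounded; (iv) $\Pi$ is the set of all measurable selectors of $C$; (v) for every $(s,a)\in\mathrm{Graph}(C)$ there is a policy $\pi_{s,a}\in\Pi$ with $\pi_{s,a}(s)=a$. Then there is an optimal policy $\pi^*\in\Pi$ satisfying $V_{\pi^*}=V^*$. Moreover, for every bounded upper semicontinuous initial guess $V_0:\mathcal S\to\mathbb R$, the value iteration sequence defined by $$V_{n+1}(s)=\sup_{a\in C(s)}\{r(s,a)+\gamma V_n(f(s,a))\},\qquad s\in\mathcal S,\ n\ge 0,$$ converges to $V^*$ (in the supremum norm) as $n\to\infty$.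
   Context: All metric spaces are nonempty and carry their Borel $\sigma$-algebras; subsets of metric spaces and products of metric spaces are regarded as metric spaces in the usual way. For metric spaces $X,Y$, a correspondence is a map $C:X\to\mathcal P(Y)$ into the powerset of $Y$, with $\mathrm{Graph}(C)=\{(x,y)\in X\times Y: y\in C(x)\}$. If $C(x)\neq\emptyset$ for all $x$, a selector of $C$ is a function $g:X\to Y$ with $g(x)\in C(x)$ for all $x$. $C$ is upper hemicontinuous if for every closed $B\subseteq Y$ the lower preimage $\{x\in X: C(x)\cap B\ne\emptyset\}$ is closed. A bounded measurable function $g:X\to\mathbb R$ is upper semicontinuous if $\{x: g(x)\ge c\}$ is closed in $X$ for every $c\in\mathbb R$. A metric MDP is a tuple $(\mathcal S,\mathcal A,C,f,r,\gamma)$ with $\mathcal S,\mathcal A$ nonempty separable metric spaces, $C:\mathcal S\to\mathcal P(\mathcal A)$ with $C(s)\ne\emptyset$ for all $s$, $f:\mathrm{Graph}(C)\to\mathcal S$ and $r:\mathrm{Graph}(C)\to\mathbb R$ measurable, and $\gamma\in[0,1)$. A policy is a selector $\pi$ of $C$. Put $f_\pi(s)=f(s,\pi(s))$, $r_\pi(s)=r(s,\pi(s))$, and let $f_\pi^t$ be the $t$-fold composition of $f_\pi$. The value function is $V_\pi(s)=\sum_{t=0}^\infty\gamma^t r_\pi(f_\pi^t(s))$ (absolutely convergent for every $s$ when $r$ is bounded). The optimal value function is $V^*(s)=\sup_{\pi\in\Pi}V_\pi(s)$. A policy $\pi^*\in\Pi$ is optimal if $V_{\pi^*}(s)\ge V_\pi(s)$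 for all $\pi\in\Pi$ and $s\in\mathcal S$. *)

(* Defs.v *)
From HB Require Import structures.
From mathcomp Require Import all_boot all_order all_algebra.
From mathcomp Require Import all_classical all_reals all_analysis.

Set Implicit Arguments.
Unset Strict Implicit.
Unset Printing Implicit Defensive.

Import Order.TTheory GRing.Theory Num.Theory.
Import numFieldNormedType.Exports.

Local Open Scope classical_set_scope.
Local Open Scope ring_scope.

(* The library's [measurable_fun] requires pointed types, which neither an
   abstract metric space nor the graph of a correspondence is; measurability
   with respect to the Borel sigma-algebras is therefore spelled out. *)
Definition borel_measurable (X Y : topologicalType) (g : X -> Y) : Prop :=
  forall B : set Y, <<s @open Y >> B -> <<s @open X >> (g @^-1` B).

Definition separable (X : topologicalType) : Prop :=
  exists2 D : set X, countable D & dense D.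

(* Measurability is part of the notion, although it follows from the closedness
   of the superlevel sets. *)
Definition bounded_usc (R : realType) (X : topologicalType) (g : X -> R) :
    Prop :=
  [/\ bounded_fun g, borel_measurable g &
      forall c : R, closed [set x | c <= g x]].

Definition graph (X Y : Type) (C : X -> set Y) : set (X * Y) :=
  [set p | C p.1 p.2].

Definition graph_pt (X Y : Type) (C : X -> set Y) (x : X) (y : Y)
    (Cxy : C x y) : graph C :=
  exist _ (x, y) (mem_set (Cxy : graph C (x, y))).

Definition upper_hemicontinuous (X Y : topologicalType) (C : X -> set Y) :
    Prop :=
  forall B : set Y, closed B -> closed [set x | C x `&` B !=set0].

(* [graph C], used as a type, is the subtype of the product [S * A] with the
   subspace topology. *)
Record metric_mdp (R : realType) := MetricMDP {
  state : metricType R;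
  action : metricType R;
  feasible : state -> set action;
  trans : graph feasible -> state;
  reward : graph feasible -> R;
  discount : R;
  state_nonempty : [set: state] !=set0;
  action_nonempty : [set: action] !=set0;
  state_separable : separable state;
  action_separable : separable action;
  feasible_nonempty : forall s : state, feasible s !=set0;
  trans_measurable : borel_measurable trans;
  reward_measurable : borel_measurable reward;
  discount_ge0 : 0 <= discount;
  discount_lt1 : discount < 1 }.

Arguments feasible {R} m s.
Arguments trans {R} m z.
Arguments reward {R} m z.
Arguments discount {R} m.

Record policy (R : realType) (M : metric_mdp R) := Policy {
  policy_fun :> state M -> action M;
  policyP : forall s : state M, feasible M s (policy_fun s) }.

Section value.
Context {R : realType} {M : metric_mdp R}.

Definition policy_trans (pi : policy M) (s : state M) : state M :=
  trans M (graph_pt (policyP pi s)).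

Definition policy_reward (pi : policy M) (s : state M) : R :=
  reward M (graph_pt (policyP pi s)).

Definition value (pi : policy M) (s : state M) : R :=
  limn (series (fun t : nat =>
    discount M ^+ t * policy_reward pi (iter t (policy_trans pi) s))).

(* The real-valued [sup] is the genuine supremum only for nonempty sets that are
   bounded above; here and in [bellman] this is guaranteed by bounded rewards,
   together with a nonempty class [Pi] here and a bounded [V] below. *)
Definition optimal_value (Pi : set (policy M)) (s : state M) : R :=
  sup [set value pi s | pi in Pi].

Definition optimal (Pi : set (policy M)) (pistar : policy M) : Prop :=
  Pi pistar /\
  forall (pi : policy M) (s : state M), Pi pi -> value pi s <= value pistar s.

Definition bellman (V : state M -> R) (s : state M) : R :=
  sup [set q | exists (a : action M) (Csa : feasible M s a),
    q = reward M (graph_pt Csa) + discount M * V (trans M (graph_pt Csa))].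

Definition value_iteration (V0 : state M -> R) (n : nat) : state M -> R :=
  iter n bellman V0.

End value.

Definition sup_norm (R : realType) (X : Type) (g : X -> R) : \bar R :=
  ereal_sup [set `|g x|%:E | x in [set: X]].

(* Main.v *)
Require Import Defs.
From HB Require Import structures.
From mathcomp Require Import all_boot all_order all_algebra.
From mathcomp Require Import all_classical all_reals all_analysis.
From mathcomp Require Import lra.

(** Let T be the Bellman operator.  It is monotone and contracts differences
    by the discount factor g ([bellman_contract]).  With rewards bounded by rb
    and B = rb / (1 - g), the constant B satisfies T B <= B, so the iterates
    T^n B decrease; their pointwise infimum F ([bellman_fixpoint]) is a bounded
    fixed point of T ([bellman_fixpointE]), to which the iterates from any
    bounded start converge geometrically in the sup norm
    ([iter_bellman_dist]).

    Telescoping the discounted rewards along a trajectory shows that every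
    policy has value at most F, and that a policy which always plays a
    maximiser of a |-> r(s, a) + g F(f(s, a)) has value exactly F
    ([value_le_fixpoint], [value_eq_fixpoint]).  All that remains is to choose
    these maximisers in a Borel way; F is then the optimal value.

    Topology enters here.  For an upper hemicontinuous compact-valued C,
    projecting the graph of C to the state space sends closed sets to closed
    sets ([closed_uhc_projection]).  Hence T preserves upper semicontinuity,
    since the superlevel sets of T V are projections of superlevel sets of
    r + g V o f ([bellman_usc]).  The function F, as an infimum of upper
    semicontinuous functions, is one as well ([bellman_fixpoint_usc]); so
    maximisers exist, and they form a correspondence that meets every closed
    set on a Borel set of states ([argmax_compact_measurable]).

    Such a compact-valued correspondence has a Borel selector
    ([measurable_selection]): minimise the distances to the points d_0, d_1, ...
    of a dense sequence one after the other.  Each step is again passage to a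
    set of maximisers, hence keeps compactness and measurability.  Compactness
    gives the sets a common point, and there is only one, because a point is
    determined by its distances to a dense set. *)

Set Implicit Arguments.
Unset Strict Implicit.
Unset Printing Implicit Defensive.

Import Order.TTheory GRing.Theory Num.Theory.
Import numFieldNormedType.Exports.

Local Open Scope classical_set_scope.
Local Open Scope ring_scope.

(** * Compactness and upper hemicontinuity *)

(** The sets [B i] form a filter base; a cluster point of the filter lies in
    every one of them, since they are closed. *)
Lemma compact_directed_bigcap (T : topologicalType) (K : set T) (I : Type)
    (B : I -> set T) (i0 : I) :
  compact K -> (forall i, closed (B i)) -> (forall i, B i !=set0) ->
  (forall i, B i `<=` K) ->
  (forall i j, exists k, B k `<=` B i `&` B j) ->
  exists p, forall i, B i p.
Proof.
move=> cK clB B0 BK Bdir.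
have FF : Filter (filter_from [set: I] B).
  apply: filter_from_filter; first by exists i0.
  by move=> i j _ _; have [k Bk] := Bdir i j; exists k.
have PF : ProperFilter (filter_from [set: I] B).
  by apply: filter_from_proper => i _; exact: B0.
have [|p [_ clp]] := cK (filter_from [set: I] B) PF; first by exists i0.
exists p => i; apply: clB => U Up.
by apply: clp => //; exists i.
Qed.

(** The nonempty superlevel sets of [u] are nested closed subsets of [K]; a
    point common to all of them is a maximiser. *)
Lemma compact_usc_max (R : realType) (T : topologicalType) (K : set T)
    (u : T -> R) :
  compact K -> K !=set0 -> (forall c, closed (K `&` [set y | c <= u y])) ->
  exists2 y, K y & forall z, K z -> u z <= u y.
Proof.
move=> cK [y0 Ky0] cl.
have [||||p Bp] := @compact_directed_bigcap T K {y | K y}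
    (fun y => K `&` [set z | u (sval y) <= u z]) (exist _ y0 Ky0) cK.
- by move=> i; exact: cl.
- by case=> y Ky; exists y; split => //=.
- by move=> i z [].
- move=> [y Ky] [z Kz]; have [yz|zy] := leP (u y) (u z).
    exists (exist _ z Kz) => w /= [Kw zw]; split; split => //=.
    exact: le_trans zw.
  exists (exist _ y Ky) => w /= [Kw yw]; split; split => //=.
  by apply: le_trans yw; exact: ltW.
exists p; first by have [] := Bp (exist _ y0 Ky0).
by move=> z Kz; have [] := Bp (exist _ z Kz).
Qed.

(** A tube argument.  If no point of [K] lies above [x], compactness of [C x]
    gives one neighbourhood [U] of [x] and one open [N] containing [C x] with
    [U] x [N] disjoint from [K]; upper hemicontinuity keeps [C t] inside [N] for
    [t] near [x]. *)
Lemma closed_uhc_projection (X Y : topologicalType) (C : X -> set Y)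
    (K : set (X * Y)) :
  (forall x, compact (C x)) -> upper_hemicontinuous C -> closed K ->
  closed [set x | exists2 y, C x y & K (x, y)].
Proof.
move=> cC uC clK; rewrite -openC openE /= => x nKx; rewrite /interior /=.
have /compact_near_coveringP cov := cC x.
pose P (U : set X) (y : Y) := nbhs y [set b | forall t, U t -> ~ K (t, b)].
(* Covering [C x] with the small neighbourhoods of [x] as the parameter makes
   one [U] work for all points of [C x] at once. *)
have : \forall U \near powerset_filter_from (nbhs x), C x `<=` P U.
  apply: cov => y Cy.
  have : nbhs (x, y) (~` K).
    apply: open_nbhs_nbhs; split; first by rewrite openC.
    by move=> Kxy; apply: nKx; exists y.
  case=> -[U V] /= [nU nV] UVK.
  have [V' [oV' V'y] V'V] : exists2 V', open_nbhs y V' & V' `<=` V.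
    by move: nV; rewrite nbhsE.
  exists (V', [set W | nbhs x W /\ W `<=` U]) => /=.
    by split; [exact: open_nbhs_nbhs|exact: powerset_filter_fromP].
  move=> [b W] /= [V'b [_ WU]].
  apply: filterS (open_nbhs_nbhs (conj oV' V'b)) => b' V'b' t Wt.
  by apply: (UVK (t, b')); split; [exact: WU|exact: V'V].
move=> /near_powerset_filter_fromP [|U nU HU].
  by move=> U V UV HV y Cy; apply: filterS (HV y Cy) => b Vb t /UV; exact: Vb.
pose N := [set b | forall t, U t -> ~ K (t, b)].
have : nbhs x (~` [set x | C x `&` ~` interior N !=set0]).
  apply: open_nbhs_nbhs; split.
    by rewrite openC; apply: uC; rewrite closedC; exact: open_interior.
  by move=> [y [Cy nNy]]; apply: nNy; exact: HU.
move=> nCN; near=> t => -[y Cy Kty].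
have Ut : U t by near: t.
have : (~` [set x | C x `&` ~` interior N !=set0]) t by near: t.
apply; exists y; split=> // /interior_subset /(_ t Ut); exact.
Unshelve. all: by end_near.
Qed.

(** * Borel selection from compact-valued correspondences *)

(** Stated on the generated sigma-algebra and not on a measurable type, as [X]
    need not be pointed. *)
Definition borel (X : topologicalType) : set (set X) := <<s @open X >>.

Lemma borel_setC (X : topologicalType) (A : set X) :
  borel A -> borel (~` A).
Proof. by rewrite -setTD; exact: sigma_algebraCD. Qed.

Lemma borel_closed (X : topologicalType) (A : set X) :
  closed A -> borel A.
Proof.
move=> cA; rewrite -[A]setCK; apply: borel_setC.
by apply: sub_sigma_algebra; rewrite openC.
Qed.

Lemma borel_bigcap (X : topologicalType) (I : countType) (A : I -> set X) :
  (forall i, borel (A i)) -> borel (\bigcap_i A i).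
Proof.
move=> bA; rewrite -[\bigcap_i _]setCK; apply: borel_setC; rewrite setC_bigcap.
rewrite [X in borel X](_ : _ =
    \bigcup_n if unpickle n is Some i then ~` A i else set0).
  apply: sigma_algebra_bigcup => n; case: unpickle => [i|].
    exact: borel_setC.
  exact: sigma_algebra0.
apply/seteqP; split => x.
  by case=> i _ nAx; exists (pickle i) => //; rewrite pickleK.
by case=> n _; case: unpickle => [i nAx|//]; exists i.
Qed.

Lemma borel_imply (X : topologicalType) (A B : set X) :
  borel A -> borel B -> borel [set x | A x -> B x].
Proof.
move=> bA bB; rewrite [X in borel X](_ : _ =
    ~` \bigcap_(b in [set: bool]) if b then A else ~` B).
  apply: borel_setC; apply: borel_bigcap => -[//|]; exact: borel_setC.
apply/seteqP; split => x.
  by move=> AB nAB; apply: (nAB false) => //; apply: AB; exact: (nAB true).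
by move=> nAB Ax; apply: contrapT => nBx; apply: nAB => -[].
Qed.

Definition hit (X Y : Type) (Phi : X -> set Y) (F : set Y) : set X :=
  [set x | Phi x `&` F !=set0].

(** Only closed sets are tested: the property then survives the passage to
    maximisers of upper semicontinuous functions, and it is still enough for a
    Borel selector. *)
Definition compact_measurable (X Y : topologicalType) (Phi : X -> set Y) :=
  [/\ forall x, compact (Phi x), forall x, Phi x !=set0 &
      forall F, closed F -> borel (hit Phi F)].

Definition argmax (R : realType) (X Y : Type) (Phi : X -> set Y)
    (u : X -> Y -> R) (x : X) : set Y :=
  [set y | Phi x y /\ forall z, Phi x z -> u x z <= u x y].

(** For fixed [x], [u x] attains its maximum over the compact set [Phi x], and
    also over [Phi x `&` F] when this is nonempty.  Thus a maximiser lies in [F]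
    iff the two maxima agree, that is iff every rational level reached on
    [Phi x] is also reached on [Phi x `&` F]: a countable condition. *)
Lemma argmax_compact_measurable (R : realType) (X Y : topologicalType)
    (Phi : X -> set Y) (u : X -> Y -> R) :
  (forall x, compact (Phi x)) -> (forall x, Phi x !=set0) ->
  (forall x c, closed (Phi x `&` [set y | c <= u x y])) ->
  (forall F c, closed F ->
    borel [set x | exists2 y, Phi x y & F y /\ c <= u x y]) ->
  compact_measurable (argmax Phi u).
Proof.
move=> cPhi Phi0 cl meas; split => [x|x|F cF].
- apply: subclosed_compact (cPhi x) _; last by move=> y [].
  rewrite [X in closed X](_ : _ =
      \bigcap_(z in Phi x) (Phi x `&` [set y | u x z <= u x y])).
    by apply: closed_bigI => z _; exact: cl.
  apply/seteqP; split => y.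
    by move=> [Py ymax] z Pz; split => //=; exact: ymax.
  have [z Pz] := Phi0 x.
  move=> ymax; have [Py _] := ymax z Pz; split => // w Pw.
  by have [_] := ymax w Pw.
- by have [y Py ymax] := compact_usc_max (cPhi x) (Phi0 x) (cl x); exists y.
pose above G c := [set x | exists2 y, Phi x y & G y /\ c <= u x y].
rewrite [X in borel X](_ : _ = \bigcap_q
    [set x | above setT (ratr q) x -> above F (ratr q) x]); last first.
  apply/seteqP; split => x.
    move=> [y [[Py ymax] Fy]] q _ [z Pz [_ qz]]; exists y => //; split => //.
    exact: le_trans (ymax z Pz).
  move=> H; have PhiF0 : Phi x `&` F !=set0.
    have [z Pz] := Phi0 x.
    (* Any rational level that [Phi x] reaches forces [F] to meet [Phi x]. *)
    have /rat_in_itvoo[q /itvP qz] : u x z - 1 < u x z by rewrite gtrDl ltrN10.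
    have [|y Py [Fy _]] := H q I; last by exists y.
    by exists z => //; split => //; rewrite qz.
  have cPF : compact (Phi x `&` F).
    exact: compact_closedI.
  have [|y [Py Fy] ymax] := @compact_usc_max R Y _ (u x) cPF PhiF0.
    by move=> c; rewrite setIAC; exact: closedI.
  exists y; split => //; split => // z Pz; rewrite leNgt; apply/negP.
  move=> /rat_in_itvoo[q /itvP qyz].
  have [|w Pw [Fw qw]] := H q I.
    by exists z => //; split => //; rewrite qyz.
  have := le_trans qw (ymax w (conj Pw Fw)).
  by rewrite leNgt qyz.
apply: borel_bigcap => q; apply: borel_imply; exact: meas.
Qed.

Lemma closed_le_mdist (R : realType) (Y : metricType R) (y : Y) (c : R) :
  closed [set z | c <= - mdist y z].
Proof.
rewrite -openC openE => z /= /negP; rewrite -ltNge => cz; rewrite /interior /=.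
have e0 : 0 < c + mdist y z by lra.
apply/nbhs_ballP; exists (c + mdist y z) => //= w.
rewrite ballEmdist /= => zw; apply/negP; rewrite -ltNge.
by have := metric_triangle y w z; rewrite (metric_sym w z); lra.
Qed.

(** [P k] collects the points of [Phi x] that lexicographically minimise the
    distances to [d 0], ..., [d k.-1]; the selector is the only point lying in
    all of them.  It falls in a closed [F] iff every [P k x] meets [F], again by
    compactness. *)
Lemma measurable_selection (R : realType) (X : topologicalType)
    (Y : metricType R) (Phi : X -> set Y) :
  separable Y -> [set: Y] !=set0 -> compact_measurable Phi ->
  exists2 g : X -> Y, (forall x, Phi x (g x)) & borel_measurable g.
Proof.
move=> [D cD dD] Y0 cmPhi.
have D0 : D !=set0.
  by have := dD setT Y0 openT; rewrite setTI.
have [d dE] : exists d : nat -> Y, D `<=` range d.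
  have /pfcard_geP[D0'|[f]] := cD; first by rewrite D0' in D0; case: D0.
  by exists f => y Dy; have [n _ <-] := 'surj_f Dy; exists n.
pose P := fix P k :=
  if k is k'.+1 then argmax (P k') (fun _ y => - mdist (d k') y) else Phi.
have cmP k : compact_measurable (P k).
  elim: k => //= k [cPk Pk0 mPk].
  have clF c F : closed F -> closed (F `&` [set y | c <= - mdist (d k) y]).
    by move=> cF; apply: closedI => //; exact: closed_le_mdist.
  apply: argmax_compact_measurable => //.
    move=> x c; apply: clF; apply: compact_closed => //.
    exact: metric_hausdorff.
  move=> F c cF; rewrite [X in borel X](_ : _ =
    hit (P k) (F `&` [set y | c <= - mdist (d k) y])).
    by apply: mPk; exact: clF.
  apply/seteqP; split => x.
    by move=> [y Py Fy]; exists y.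
  by move=> [y [Py Fy]]; exists y.
have Pmono k l x : (k <= l)%N -> P l x `<=` P k x.
  elim: l => [|l IHl]; first by rewrite leqn0 => /eqP ->.
  rewrite leq_eqVlt => /orP[/eqP <- //|]; rewrite ltnS => /IHl Plk y.
  by move=> [/Plk].
have Pinter F x : closed F -> (forall k, (P k x `&` F) !=set0) ->
    exists y, forall k, (P k x `&` F) y.
  move=> cF P0; have [cP0 _ _] := cmP 0%N.
  apply: (@compact_directed_bigcap Y (Phi x) nat _ 0%N) => //=.
  - move=> k; apply: closedI => //; have [cPk _ _] := cmP k.
    by apply: compact_closed => //; exact: metric_hausdorff.
  - by move=> k y [/(@Pmono 0%N k x (leq0n k))].
  move=> k l; exists (maxn k l) => y [Py Fy].
  by split; split => //; apply: Pmono Py; rewrite (leq_maxl, leq_maxr).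
have /choice[g gP] : forall x, exists y, forall k, P k x y.
  move=> x; have [|k|y Hy] := @Pinter setT x; first exact: closedT.
    by rewrite setIT; have [_ + _] := cmP k.
  by exists y => k; have [] := Hy k.
(* Two points in all the [P k x] are equidistant from every [d k], in
   particular from one much closer to [y] than to [z] if these differ. *)
have Puniq x y z : (forall k, P k x y) -> (forall k, P k x z) -> y = z.
  move=> Py Pz; apply: contrapT => /eqP; rewrite -mdist_gt0 => yz.
  have e0 : 0 < mdist y z / 2 by rewrite divr_gt0.
  have [w [] ] : (interior (ball y (mdist y z / 2)) `&` D) !=set0.
    apply: dD; last exact: open_interior.
    by exists y; exact: nbhsx_ballx.
  move=> /interior_subset.
  rewrite ballEmdist /= => yw /dE[k _ dk].
  have [_ /(_ _ (Pz k))] := Py k.+1; have [_ /(_ _ (Py k))] := Pz k.+1.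
  rewrite dk !lerN2 => h1 h2; have wyz : mdist w y = mdist w z.
    by apply/eqP; rewrite eq_le h1 h2.
  have := metric_triangle y w z; rewrite -wyz (metric_sym w y); lra.
exists g; first by move=> x; exact: (gP x 0%N).
move=> B.
apply: (@smallest_sub _ (sigma_algebra setT) _ [set B | borel (g @^-1` B)]).
  split => /=.
  - by rewrite preimage_set0; exact: sigma_algebra0.
  - by move=> A bA; rewrite setTD preimage_setC; exact: borel_setC.
  - by move=> A bA; rewrite preimage_bigcup; exact: sigma_algebra_bigcup.
move=> U oU /=; rewrite -[U]setCK preimage_setC; apply: borel_setC.
have cF : closed (~` U) by rewrite closedC.
rewrite [X in borel X](_ : _ = \bigcap_k hit (P k) (~` U)).
  by apply: borel_bigcap => k; have [_ _] := cmP k; exact.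
apply/seteqP; split => x.
  by move=> Fgx k _; exists (g x); split.
move=> H; have [|y Hy] := Pinter _ x cF; first by move=> k; exact: H.
have <- : y = g x by apply: Puniq (gP x) => k; have [] := Hy k.
by have [] := Hy 0%N.
Qed.

(** * Upper semicontinuous functions on the graph of a correspondence *)

Lemma closed_graph_trace (X Y : topologicalType) (C : X -> set Y)
    (K : set (graph C)) :
  closed K -> exists2 K' : set (X * Y), closed K' &
    forall x y (Cxy : C x y), K (graph_pt Cxy) <-> K' (x, y).
Proof.
rewrite -openC => -[U oU UK]; exists (~` U); first by rewrite closedC.
move=> x y Cxy; rewrite -[K]setCK -UK; exact: iff_refl.
Qed.

(** The value 0 off the graph is a dummy: extending [q] to the product makes it
    an ordinary two-variable function whose arguments carry no proofs. *)
Definition graph_ext (R : realType) (X Y : Type) (C : X -> set Y)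
    (q : graph C -> R) (x : X) (y : Y) : R :=
  if pselect (C x y) is left Cxy then q (graph_pt Cxy) else 0.

Lemma graph_extE (R : realType) (X Y : Type) (C : X -> set Y)
    (q : graph C -> R) (x : X) (y : Y) (Cxy : C x y) :
  graph_ext q x y = q (graph_pt Cxy).
Proof.
by rewrite /graph_ext; case: pselect => // h; rewrite (Prop_irrelevance h Cxy).
Qed.

Section graph_ext_usc.
Context {R : realType} {X Y : topologicalType} {C : X -> set Y}.
Variable q : graph C -> R.
Hypothesis C_compact : forall x, compact (C x).
Hypothesis q_usc : forall c, closed [set z | c <= q z].

Lemma graph_ext_superlevel c : exists2 K : set (X * Y), closed K &
  forall x y, C x y -> c <= graph_ext q x y <-> K (x, y).
Proof.
have [K cK KE] := closed_graph_trace (@q_usc c).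
by exists K => // x y Cxy; rewrite (graph_extE q Cxy); exact: KE.
Qed.

Lemma graph_ext_closed_fiber x c : hausdorff_space Y ->
  closed (C x `&` [set y | c <= graph_ext q x y]).
Proof.
move=> hY; have [K cK KE] := graph_ext_superlevel c.
rewrite (_ : _ `&` _ = C x `&` (pair x) @^-1` K).
  apply: closedI; first exact: compact_closed.
  apply: preimage_closed => // y _; apply: cvg_pair => //; exact: cvg_cst.
by apply/seteqP; split => y [Cxy] /(KE _ _ Cxy).
Qed.

Lemma graph_ext_closed_hit (F : set Y) c :
  upper_hemicontinuous C -> closed F ->
  closed [set x | exists2 y, C x y & F y /\ c <= graph_ext q x y].
Proof.
move=> uC cF; have [K cK KE] := graph_ext_superlevel c.
have cKF : closed (K `&` snd @^-1` F).
  by apply: closedI => //; apply: preimage_closed => // z _; exact: cvg_snd.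
have := closed_uhc_projection C_compact uC cKF; congr closed.
apply/seteqP; split => x [y Cxy].
  by move=> [/= /(KE _ _ Cxy) ? ?]; exists y.
by move=> [? /(KE _ _ Cxy) ?]; exists y.
Qed.

End graph_ext_usc.

(** * The Bellman operator and its fixed point *)

Lemma bounded_fun_norm_le (R : realType) (X : Type) (g : X -> R) :
  bounded_fun g -> exists2 b, 0 <= b & forall x, `|g x| <= b.
Proof.
move=> [N [_ Ng]]; exists (`|N| + 1) => [|x]; first by rewrite addr_ge0.
by apply: Ng => //; rewrite (le_lt_trans (ler_norm N))// ltrDl.
Qed.

(** Removes a geometric error term, so that the estimates in which it arises
    need no limits themselves. *)
Lemma le_add_geometric (R : realType) (g c x y : R) : 0 <= g -> g < 1 ->
  (forall n, x <= y + g ^+ n * c) -> x <= y.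
Proof.
move=> g0 g1 H; have : (fun n => y + g ^+ n * c) @ \oo --> y.
  rewrite -[X in _ --> X]addr0 -(mul0r c); apply: cvgD; first exact: cvg_cst.
  by apply: cvgMl; apply: cvg_expr; rewrite ger0_norm.
move=> cv; rewrite -(cvg_lim _ cv) //; apply: limr_ge.
  by apply/cvg_ex; exists y.
by apply: nearW.
Qed.

Section mdp.
Context {R : realType} (M : metric_mdp R).
Notation S := (state M).
Notation C := (feasible M).
Notation g := (discount M).

Let g0 : 0 <= g := discount_ge0 M.
Let g1 : g < 1 := discount_lt1 M.
Let gX n : 0 <= g ^+ n := exprn_ge0 n g0.

Definition qvalue (V : S -> R) (z : graph C) : R :=
  reward M z + g * V (trans M z).

(** A sum of upper semicontinuous functions: the strict sublevel set at [c] is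
    the union, over thresholds [(t, v)] with [t + g v <= c], of the open sets
    where the reward is below [t] and the next value below [v].  Keeping [g]
    outside the threshold [v] avoids a case distinction on [g = 0]. *)
Lemma qvalue_usc (V : S -> R) : continuous (trans M) ->
  (forall c, closed [set z | c <= reward M z]) ->
  (forall c, closed [set s | c <= V s]) ->
  forall c, closed [set z | c <= qvalue V z].
Proof.
move=> f_cont r_usc V_usc c.
pose D := [set p : R * R | p.1 + g * p.2 <= c].
rewrite -openC (_ : ~` _ = \bigcup_(p in D)
    (~` [set z | p.1 <= reward M z] `&`
     trans M @^-1` (~` [set s | p.2 <= V s]))).
  apply: bigcup_open => p _; apply: openI; first by rewrite openC.
  by apply: open_comp; [move=> z _; exact: f_cont|rewrite openC].
apply/seteqP; split => z /=.
  move=> /negP; rewrite -ltNge /qvalue => zc.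
  pose d := (c - (reward M z + g * V (trans M z))) / 2.
  have d0 : 0 < d by rewrite divr_gt0 // subr_gt0.
  have gd : g * d <= d by rewrite ler_piMl // ltW.
  exists (reward M z + d, V (trans M z) + d); last first.
    by split; apply/negP; rewrite -ltNge ltrDl.
  by rewrite /D /= mulrDr; rewrite /d in gd *; lra.
move=> [[t v] /= tvc [/negP + /negP +]]; rewrite -!ltNge => rt Vv.
apply/negP; rewrite -ltNge; apply: lt_le_trans tvc.
by rewrite /qvalue ltr_leD // ler_wpM2l // ltW.
Qed.

Section bounded_reward.
Variable rb : R.
Hypothesis rb0 : 0 <= rb.
Hypothesis r_le : forall z, `|reward M z| <= rb.

(** Boundedness above is what makes [sup] in [bellman] a genuine supremum. *)
Definition bounded_above (V : S -> R) := exists b, forall s, V s <= b.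

Lemma qvalue_le_bellman V s a : bounded_above V -> C s a ->
  graph_ext (qvalue V) s a <= bellman V s.
Proof.
move=> [b Vb] Csa; rewrite (graph_extE _ Csa).
apply: ub_le_sup; last by exists a, Csa.
exists (rb + g * b) => _ [a' [Csa' ->]]; apply: lerD.
  exact: le_trans (ler_norm _) (r_le _).
exact: ler_wpM2l.
Qed.

Lemma bellman_le V s c :
  (forall a, C s a -> graph_ext (qvalue V) s a <= c) -> bellman V s <= c.
Proof.
move=> H; apply: ge_sup; last first.
  by move=> _ [a [Csa ->]]; rewrite -/(qvalue V _) -graph_extE; exact: H.
have [a Csa] := feasible_nonempty s.
by exists (qvalue V (graph_pt Csa)), a, Csa.
Qed.

(** Monotonicity is the case [e = 0]; the contraction property is the
    conjunction of both one-sided estimates. *)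
Lemma bellman_contract V W e : bounded_above W ->
  (forall s, V s <= W s + e) ->
  forall s, bellman V s <= bellman W s + g * e.
Proof.
move=> Wb VW s; apply: bellman_le => a Csa.
apply: (@le_trans _ _ (graph_ext (qvalue W) s a + g * e)).
  by rewrite !(graph_extE _ Csa) /qvalue -addrA -mulrDr lerD2l ler_wpM2l.
by rewrite lerD2r; exact: qvalue_le_bellman.
Qed.

Lemma bellman_bounded_above V : bounded_above V -> bounded_above (bellman V).
Proof.
move=> [b Vb]; exists (rb + g * b) => s; apply: bellman_le => a Csa.
rewrite (graph_extE _ Csa); apply: lerD.
  exact: le_trans (ler_norm _) (r_le _).
exact: ler_wpM2l.
Qed.

Lemma iter_bellman_bounded_above V n :
  bounded_above V -> bounded_above (iter n bellman V).
Proof. by move=> Vb; elim: n => //= n; exact: bellman_bounded_above. Qed.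

Lemma iter_bellman_contract V W e n : bounded_above W ->
  (forall s, V s <= W s + e) ->
  forall s, iter n bellman V s <= iter n bellman W s + g ^+ n * e.
Proof.
move=> Wb VW; elim: n => [s|n IHn s] /=; first by rewrite expr0 mul1r.
rewrite exprS -mulrA; apply: bellman_contract => //.
exact: iter_bellman_bounded_above.
Qed.

(* The sum over t of g ^ t * rb, which bounds every discounted total reward. *)
Let B := rb / (1 - g).

Let B0 : 0 <= B.
Proof. by rewrite divr_ge0 // subr_ge0 ltW. Qed.

Let BE : rb + g * B = B.
Proof.
have h : 1 - g != 0 by rewrite subr_eq0 eq_sym lt_eqF.
have : B * (1 - g) = rb by rewrite /B divfK.
by move=> <-; lra.
Qed.

Let W n : S -> R := iter n bellman (fun=> B).

Let W_bounded_above n : bounded_above (W n).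
Proof. by apply: iter_bellman_bounded_above; exists B. Qed.

Let bellman_geN V s : bounded_above V -> (forall s, - B <= V s) ->
  - B <= bellman V s.
Proof.
move=> Vb VB; have [a Csa] := feasible_nonempty s.
apply: le_trans (qvalue_le_bellman Vb Csa).
rewrite (graph_extE _ Csa) -BE opprD -mulrN; apply: lerD; last exact: ler_wpM2l.
by rewrite lerNl (le_trans _ (r_le (graph_pt Csa))) // -normrN ler_norm.
Qed.

Let W_geN n s : - B <= W n s.
Proof.
elim: n s => [s|n IHn s]; first by rewrite /W /= (le_trans _ B0) // oppr_le0.
exact: bellman_geN.
Qed.

Let W_leS n s : W n.+1 s <= W n s.
Proof.
elim: n s => [s|n IHn s].
  apply: bellman_le => a Csa; rewrite (graph_extE _ Csa).
  apply: (@le_trans _ _ (rb + g * B)); last by rewrite BE.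
  apply: lerD; last by [].
  exact: le_trans (ler_norm _) (r_le _).
have := @bellman_contract (W n.+1) (W n) 0 (W_bounded_above n) _ s.
by rewrite mulr0 addr0; apply => t; rewrite addr0.
Qed.

Let W_anti m n s : (m <= n)%N -> W n s <= W m s.
Proof.
elim: n => [|n IHn]; first by rewrite leqn0 => /eqP ->.
rewrite leq_eqVlt => /orP[/eqP -> //|]; rewrite ltnS => /IHn.
exact: le_trans.
Qed.

(* Compare [W n] with [W (n + k)]: both apply the operator [n] times, to the
   functions [B] and [W k], which differ by at most [2 * B]. *)
Let W_cauchy n k s : W n s <= W k s + g ^+ n * (2 * B).
Proof.
apply: (@le_trans _ _ (W (n + k) s + g ^+ n * (2 * B))).
  rewrite /W iterD; apply: iter_bellman_contract => [|t].
    exact: W_bounded_above.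
  by have := W_geN k t; rewrite /W; lra.
by rewrite lerD2r W_anti // leq_addl.
Qed.

(** Taking the infimum of a decreasing sequence keeps upper semicontinuity at no
    cost, which is why the iteration starts from the supersolution [B]. *)
Definition bellman_fixpoint (s : S) : R := inf [set W n s | n in [set: nat]].

Notation Vbar := bellman_fixpoint.

Let Vbar_le n s : Vbar s <= W n s.
Proof.
apply: ge_inf; last by exists n.
by exists (- B) => _ [k _ <-].
Qed.

Let Vbar_ge x s : (forall n, x <= W n s) -> x <= Vbar s.
Proof.
move=> H; apply: lb_le_inf; first by exists (W 0 s), 0%N.
by move=> _ [k _ <-].
Qed.

Lemma bellman_fixpoint_norm s : `|Vbar s| <= B.
Proof. by rewrite ler_norml (Vbar_le 0) Vbar_ge. Qed.

(** The inequality [<=] is monotonicity alone; [>=] needs the geometric rate, as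
    the operator need not commute with infima. *)
Lemma bellman_fixpointE : bellman Vbar = Vbar.
Proof.
have Vb : bounded_above Vbar by exists B; exact: (Vbar_le 0).
apply/funext => s; apply/eqP; rewrite eq_le; apply/andP; split.
  apply: Vbar_ge => n; apply: le_trans (W_leS n s).
  have := @bellman_contract Vbar (W n) 0 (W_bounded_above n) _ s.
  by rewrite mulr0 addr0; apply => t; rewrite addr0.
apply: (@le_add_geometric _ g (g * (2 * B))) => // n.
apply: le_trans (Vbar_le n.+1 s) _.
rewrite mulrCA; apply: bellman_contract => // t.
by rewrite -lerBlDr; apply: Vbar_ge => k; rewrite lerBlDr.
Qed.

Lemma iter_bellman_fixpoint n : iter n bellman Vbar = Vbar.
Proof. by elim: n => //= n ->; exact: bellman_fixpointE. Qed.

Lemma iter_bellman_dist V d n s : (forall s, `|V s| <= d) ->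
  `|iter n bellman V s - Vbar s| <= g ^+ n * (d + B).
Proof.
move=> Vd.
have dist t : `|V t - Vbar t| <= d + B.
  by rewrite (le_trans (ler_normB _ _)) // lerD // bellman_fixpoint_norm.
have Vb : bounded_above V by exists d => t; exact: le_trans (ler_norm _) (Vd t).
have Fb : bounded_above Vbar by exists B; exact: (Vbar_le 0).
have := @iter_bellman_contract V Vbar (d + B) n Fb _ s.
have := @iter_bellman_contract Vbar V (d + B) n Vb _ s.
rewrite iter_bellman_fixpoint => FV VF.
rewrite ler_distl lerBlDr FV ?VF // => t;
  have := dist t; rewrite ler_distl => /andP[]; lra.
Qed.

(** * Values of policies *)

Section value.
Variable pi : policy M.

Let path s t := iter t (policy_trans pi) s.

Let series_value s n :=
  series (fun t => g ^+ t * policy_reward pi (path s t)) n.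

Let series_value_cvg s : cvgn (series_value s).
Proof.
apply: normed_cvg.
apply: (@series_le_cvg _ _ (fun t => rb * g ^+ t)) => [t|t|t|].
- exact: normr_ge0.
- by rewrite mulr_ge0.
- rewrite /= normrM (ger0_norm (gX t)) [leRHS]mulrC ler_wpM2l //.
  exact: r_le.
- by apply: is_cvg_geometric_series; rewrite ger0_norm.
Qed.

(* The remainder left after [k] rewards, estimated by the one after [n]. *)
Let tail_le V d s n k : (forall s, `|V s| <= d) -> (n <= k)%N ->
  `|g ^+ k * V (path s k)| <= g ^+ n * d.
Proof.
move=> Vd nk; rewrite normrM (ger0_norm (gX k)) ler_pM //.
by rewrite ler_wiXn2l // ltW.
Qed.

(** Iterating the hypothesis bounds the rewards collected in [k] steps plus the
    discounted [V] at step [k] by [V s], and this remainder vanishes in the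
    limit. *)
Lemma value_le V d s : (forall s, `|V s| <= d) ->
  (forall s, policy_reward pi s + g * V (policy_trans pi s) <= V s) ->
  value pi s <= V s.
Proof.
move=> Vd Vsup; apply: (@le_add_geometric _ g d) => // n.
have part k : series_value s k + g ^+ k * V (path s k) <= V s.
  elim: k => [|k IHk].
    by rewrite /series_value /series /= big_geq // add0r expr0 mul1r.
  rewrite /series_value seriesSr; apply: le_trans IHk.
  by rewrite -addrA lerD2l exprSr -mulrA -mulrDr ler_wpM2l.
apply: limr_le; first exact: series_value_cvg.
exists n => // k /= nk.
have := tail_le s Vd nk; rewrite ler_norml.
by have := part k; rewrite /series_value; lra.
Qed.

Lemma le_value V d s : (forall s, `|V s| <= d) ->
  (forall s, V s <= policy_reward pi s + g * V (policy_trans pi s)) ->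
  V s <= value pi s.
Proof.
move=> Vd Vsub; apply: (@le_add_geometric _ g d) => // n.
have part k : V s <= series_value s k + g ^+ k * V (path s k).
  elim: k => [|k IHk].
    by rewrite /series_value /series /= big_geq // add0r expr0 mul1r.
  rewrite /series_value seriesSr; apply: le_trans IHk _.
  by rewrite -addrA lerD2l exprSr -mulrA -mulrDr ler_wpM2l.
rewrite -lerBlDr; apply: limr_ge; first exact: series_value_cvg.
exists n => // k /= nk.
have := tail_le s Vd nk; rewrite ler_norml.
by have := part k; rewrite /series_value; lra.
Qed.

End value.

Lemma value_le_fixpoint (pi : policy M) s : value pi s <= Vbar s.
Proof.
apply: (value_le _ bellman_fixpoint_norm) => t.
have Vb : bounded_above Vbar by exists B; exact: (Vbar_le 0).
have := qvalue_le_bellman Vb (policyP pi t).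
by rewrite bellman_fixpointE (graph_extE _ (policyP pi t)).
Qed.

Lemma value_eq_fixpoint (pi : policy M) :
  (forall s, argmax C (graph_ext (qvalue Vbar)) s (pi s)) -> value pi = Vbar.
Proof.
move=> pi_greedy; apply/funext => s; apply/eqP.
rewrite eq_le value_le_fixpoint; apply: (le_value _ bellman_fixpoint_norm) => t.
rewrite -{1}bellman_fixpointE; apply: bellman_le => a Cta.
have [_ /(_ _ Cta)] := pi_greedy t.
by rewrite (graph_extE _ (policyP pi t)).
Qed.

(** * Convergence of value iteration *)

Lemma sup_norm_value_iteration V d : (forall s, `|V s| <= d) ->
  (fun n => sup_norm (fun s => value_iteration V n s - Vbar s)) @ \oo -->
    (0 : \bar R)%E.
Proof.
move=> Vd; have [s0 _] := state_nonempty M.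
apply: (@squeeze_cvge _ _ _ _ (fun=> 0%E) _ (fun n => (g ^+ n * (d + B))%:E)).
- apply: nearW => n; apply/andP; split.
    apply: le_trans (ereal_sup_ubound _); last by exists s0.
    by rewrite lee_fin.
  apply: ge_ereal_sup => _ [s _ <-]; rewrite lee_fin.
  exact: iter_bellman_dist.
- exact: cvg_cst.
- apply: cvg_EFin; first by apply: nearW.
  rewrite -(mul0r (d + B)); apply: cvgMl; apply: cvg_expr.
  by rewrite ger0_norm.
Qed.

(** * Semicontinuity of the fixed point and an optimal policy *)

Section usc.
Hypothesis C_compact : forall s, compact (C s).
Hypothesis C_uhc : upper_hemicontinuous C.
Hypothesis f_continuous : continuous (trans M).
Hypothesis r_usc : forall c, closed [set z | c <= reward M z].

(** Since the supremum is attained, [c <= bellman V s] means that some feasible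
    action reaches level [c]; such states form the projection of a closed subset
    of the graph. *)
Lemma bellman_usc V : bounded_above V ->
  (forall c, closed [set s | c <= V s]) ->
  forall c, closed [set s | c <= bellman V s].
Proof.
move=> Vb V_usc c.
have q_usc := qvalue_usc f_continuous r_usc V_usc.
have := graph_ext_closed_hit (c := c) C_compact q_usc C_uhc closedT.
congr closed; apply/seteqP; split => s /=.
  by move=> [a Csa [_ ca]]; exact: le_trans ca (qvalue_le_bellman Vb Csa).
move=> cs; have [|||a Csa amax] := @compact_usc_max R _ (C s)
  (graph_ext (qvalue V) s).
- exact: C_compact.
- exact: feasible_nonempty.
- by move=> e; apply: graph_ext_closed_fiber => //; exact: metric_hausdorff.
- exists a => //; split => //; apply: le_trans cs _; exact: bellman_le.
Qed.

Lemma bellman_fixpoint_usc c : closed [set s | c <= Vbar s].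
Proof.
rewrite (_ : [set s | _] = \bigcap_n [set s | c <= W n s]).
  apply: closed_bigI => n _; elim: n c => [|n IHn] c.
    have [cB|cB] := leP c B; [rewrite (_ : [set s | _] = setT)|
      rewrite (_ : [set s | _] = set0)].
    - exact: closedT.
    - by apply/seteqP; split.
    - exact: closed0.
    - by apply/seteqP; split => // s /=; rewrite /W /= leNgt cB.
  exact: bellman_usc.
apply/seteqP; split => s /=.
  by move=> cs n _; apply: le_trans cs (Vbar_le n s).
by move=> H; apply: Vbar_ge => n; exact: H.
Qed.

Lemma optimal_policy_exists :
  exists2 pi : policy M, borel_measurable (policy_fun pi) & value pi = Vbar.
Proof.
have q_usc := qvalue_usc f_continuous r_usc bellman_fixpoint_usc.
have cm : compact_measurable (argmax C (graph_ext (qvalue Vbar))).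
  apply: argmax_compact_measurable => //.
  - exact: feasible_nonempty.
  - by move=> s c; apply: graph_ext_closed_fiber => //; exact: metric_hausdorff.
  - by move=> F c cF; apply: borel_closed; exact: graph_ext_closed_hit.
have [h hP mh] :=
  measurable_selection (@action_separable _ M) (@action_nonempty _ M) cm.
exists (@Policy _ M h (fun s => (hP s).1)) => //.
exact: value_eq_fixpoint.
Qed.

End usc.
End bounded_reward.
End mdp.

Theorem theorem1 (R : realType) (M : metric_mdp R) (Pi : set (policy M))
  (C_compact : forall s : state M, compact (feasible M s))
  (C_uhc : upper_hemicontinuous (feasible M))
  (f_continuous : continuous (trans M))
  (r_bounded_usc : bounded_usc (reward M))
  (Pi_measurable_selectors :
    Pi = [set pi : policy M | borel_measurable (policy_fun pi)])
  (Pi_interpolates : forall (s : state M) (a : action M), feasible M s a ->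
    exists pi : policy M, Pi pi /\ pi s = a) :
  (exists pistar : policy M,
    optimal Pi pistar /\ value pistar = optimal_value Pi) /\
  (forall V0 : state M -> R, bounded_usc V0 ->
    (fun n : nat => sup_norm (fun s : state M =>
       value_iteration V0 n s - optimal_value Pi s))
      @ \oo --> (0 : \bar R)%E).
Proof.
have [r_bounded _ r_usc] := r_bounded_usc.
have [rb rb0 r_le] := bounded_fun_norm_le r_bounded.
have [pistar pistar_meas pistarE] :=
  optimal_policy_exists rb0 r_le C_compact C_uhc f_continuous r_usc.
have PiP : Pi pistar by rewrite Pi_measurable_selectors.
have opt pi s : value pi s <= value pistar s.
  by rewrite pistarE; exact: value_le_fixpoint.
have optE : optimal_value Pi = value pistar.
  apply/funext => s; apply/eqP; rewrite eq_le; apply/andP; split.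
    apply: ge_sup; first by exists (value pistar s), pistar.
    by move=> _ [pi _ <-].
  apply: ub_le_sup; last by exists pistar.
  by exists (value pistar s) => _ [pi _ <-].
split; first by exists pistar; split.
move=> V0 [/bounded_fun_norm_le[d _ V0d] _ _].
by rewrite optE pistarE; exact: sup_norm_value_iteration.
Qed.
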